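(* Let $3<p<\infty$ and $\frac1p+\frac1q=1$. Let $\mathfrak J:l_p\to l_q$ be the mapping $\mathfrak J(x)=\left\{\frac{|t_n|^{p-1}\mathrm{sign}(t_n)}{1+|t_n|}\right\}_{n=1}^\infty$ for $x=(t_1,t_2,\dots)\in l_p$. Then $\mathfrak J$ is Fréchet differentiable in $l_p$ and, for any $\bar x=(\bar t_1,\bar t_2,\dots)\in l_p$, $$\nabla\mathfrak J(\bar x)=\begin{pmatrix}\frac{(p-1)|\bar t_1|^{p-2}+(p-2)|\bar t_1|^{p-1}}{(1+|\bar t_1|)^2}&0&\cdots\\0&\frac{(p-1)|\bar t_2|^{p-2}+(p-2)|\bar t_2|^{p-1}}{(1+|\bar t_2|)^2}&0\\\vdots&0&\ddots\end{pmatrix}.$$ More precisely, $\nabla\mathfrak J(\bar x):l_p\to l_q$ is a pointwise multiplication operator in $l_p$ and, for $v=\{t_n\}_{n=1}^\infty\in l_p$, $$\nabla\mathfrak J(\bar x)(v)=\left\{\frac{(p-1)|\bar t_n|^{p-2}+(p-2)|\bar t_n|^{p-1}}{(1+|\bar t_n|)^2}\,t_n\right\}_{n=1}^\infty\in l_q,$$ and $$\|\nabla\mathfrak J(\bar x)(v)\|_q\le\left((p-1)\|\bar x\|_p^{p-2}+(p-2)\|\bar x\|_p^{p-1}\right)\|v\|_p.$$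
   Context: $(l_p,\|\cdot\|_p)$ and $(l_q,\|\cdot\|_q)$ are the real sequence spaces. $\nabla\mathfrak J(\bar x)$ denotes the Fréchet derivative of $\mathfrak J$ at $\bar x$, a continuous linear map $l_p\to l_q$. Infinite diagonal matrices act on sequences (viewed as row vectors) by entrywise multiplication by the diagonal entries. *)

(* Defs.v *)
From HB Require Import structures.
From mathcomp Require Import all_boot all_order all_algebra finmap.
From mathcomp Require Import all_classical all_reals all_analysis.
From mathcomp Require Import ring.
Set Implicit Arguments.
Unset Strict Implicit.
Unset Printing Implicit Defensive.
Import Order.TTheory GRing.Theory Num.Theory.
Import numFieldNormedType.Exports.

Local Open Scope classical_set_scope.
Local Open Scope ring_scope.

(* The sequence space l_p is L^p of the counting measure on nat.  Since only
   the empty set is negligible there, no quotient is needed and the L^p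
   seminorm is a norm. *)
Definition lp (R : realType) (p : R) (p1 : (1 <= p%:E)%E) : Type :=
  LfunType (@counting nat R) p1.

Section lp_normed.
Context (R : realType) (p : R) (p1 : (1 <= p%:E)%E).

HB.instance Definition _ := GRing.Lmodule.copy (lp p1)
  (LfunType (@counting nat R) p1).

Definition lp_norm (x : lp p1) : R :=
  fine ('N[@counting nat R]_(p%:E)[EFin \o (x : nat -> R)])%E.

Lemma lp_normD (x y : lp p1) : lp_norm (x + y) <= lp_norm x + lp_norm y.
Proof. exact: ler_LnormD. Qed.

Lemma lp_normZ (a : R) (x : lp p1) : lp_norm (a *: x) = `|a| * lp_norm x.
Proof.
apply/EFin_inj; rewrite EFinM /lp_norm.
by rewrite !(finite_norm_fine (p1 := p1)) LnormZ.
Qed.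

Lemma counting_negligible0 (A : set nat) :
  (@counting nat R).-negligible A -> A = set0.
Proof.
move=> [B [mB B0 AB]]; apply/seteqP; split => // n /AB Bn.
move: B0; rewrite /counting; case: ifPn => // /asboolP fB [].
move/eqP; rewrite pnatr_eq0 cardfs_eq0 => /eqP B0.
have : n \in fset_set B by rewrite in_fset_set//; exact: mem_set.
by rewrite B0 inE.
Qed.

Lemma lp_norm_eq0 (x : lp p1) : lp_norm x = 0 -> x = 0.
Proof.
move=> /(@fine_Lnormr_eq0 _ _ _ _ _ p1 x) x0; apply/LfuneqP => n.
have := counting_negligible0 x0 => /seteqP[/(_ n) /= H _].
by apply: contrapT => Hn; apply: H => H'; apply: Hn; exact: H'.
Qed.

HB.instance Definition _ :=
  Lmodule_isNormed.Build R (lp p1) lp_normD lp_normZ lp_norm_eq0.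

Lemma lp_normE (x : lp p1) :
  (`|x|%:E = (\sum_(n <oo) (`|x n| `^ p)%:E) `^ p^-1)%E.
Proof.
have p0 : 0 < p by rewrite (lt_le_trans ltr01).
rewrite -[LHS]/((lp_norm x)%:E) /lp_norm (finite_norm_fine (p1 := p1)).
by rewrite Lnorm_counting.
Qed.

End lp_normed.

Lemma in_lpP (R : realType) (p : R) (f : nat -> R) : 0 < p ->
  f \in Lfun (@counting nat R) p%:E <->
  (\sum_(n <oo) (`|f n| `^ p)%:E < +oo)%E.
Proof.
move=> p0; split.
  move=> /andP[_]; rewrite inE /= /finite_norm Lnorm_counting// => H.
  by apply: lty_poweRy H; rewrite invr_neq0// gt_eqF.
move=> H; apply/andP; split; first exact: mem_set.
by rewrite inE /= /finite_norm Lnorm_counting//; exact: poweR_lty.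
Qed.

Section exponents.
Context (R : realType) (p q : R) (p3 : 3 < p) (pq : p^-1 + q^-1 = 1).

Lemma exponent_ge1 : (1 <= p%:E)%E.
Proof. by rewrite lee_fin (le_trans _ (ltW p3))// ler1n. Qed.

Lemma conjugate_gt0 : 0 < q.
Proof.
have p0 : 0 < p by rewrite (lt_trans _ p3).
have p1 : p^-1 < 1 by rewrite invf_lt1// (lt_trans _ p3)// ltr1n.
by rewrite -invr_gt0 -(addKr p^-1 q^-1) pq addrC subr_gt0.
Qed.

Lemma conjugateE : (p - 1) * q = p.
Proof.
have q0 := conjugate_gt0.
have p0 : p != 0 by rewrite gt_eqF// (lt_trans _ p3).
have : (p^-1 + q^-1) * (p * q) = p * q by rewrite pq mul1r.
have -> : (p^-1 + q^-1) * (p * q) = p + q by field; rewrite p0 gt_eqF.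
by rewrite mulrBl mul1r => <-; rewrite addrK.
Qed.

Lemma conjugate_ge1 : (1 <= q%:E)%E.
Proof.
have p1 : 0 < p - 1 by rewrite subr_gt0 (lt_trans _ p3)// ltr1n.
by rewrite lee_fin -(ler_pM2l p1) conjugateE mulr1 gerBl.
Qed.

Definition frakJ_fun (x : nat -> R) : nat -> R :=
  fun n => `|x n| `^ (p - 1) * Num.sg (x n) / (1 + `|x n|).

Lemma frakJ_fun_le (x : nat -> R) n : `|frakJ_fun x n| <= `|x n| `^ (p - 1).
Proof.
have x0 : 0 <= `|x n| by [].
rewrite /frakJ_fun !normrM normfV (ger0_norm (powR_ge0 _ _)).
rewrite (ger0_norm (addr_ge0 ler01 x0)) ler_pdivrMr ?ltr_wpDr//.
rewrite ler_wpM2l ?powR_ge0// normr_sg.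
by rewrite (@le_trans _ _ 1) ?lerDl// lern1 leq_b1.
Qed.

Lemma frakJ_in_lq (x : lp exponent_ge1) : frakJ_fun x \in Lfun (@counting nat R) q%:E.
Proof.
have p0 : 0 < p by rewrite (lt_trans _ p3).
have q0 := conjugate_gt0.
have /(in_lpP _ p0) : (x : nat -> R) \in Lfun (@counting nat R) p%:E.
  exact: LfunP.
move=> xp; apply/in_lpP => //; apply: le_lt_trans xp.
apply: lee_nneseries => n _; first by rewrite lee_fin powR_ge0.
rewrite lee_fin -[X in _ <= _ `^ X]conjugateE powRrM.
by apply: ge0_ler_powR => //; rewrite ?nnegrE ?powR_ge0 ?(ltW q0)// frakJ_fun_le.
Qed.

Definition frakJ (x : lp exponent_ge1) : lp conjugate_ge1 :=
  Lfun_Sub conjugate_ge1 (frakJ_in_lq x).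

Lemma frakJE (x : lp exponent_ge1) (n : nat) :
  frakJ x n = `|x n| `^ (p - 1) * Num.sg (x n) / (1 + `|x n|).
Proof. by []. Qed.

End exponents.
Arguments frakJ {R p q} p3 pq x.

(* Action of the infinite diagonal matrix with diagonal d on a sequence. *)
Definition diag_act (R : realType) (d v : nat -> R) : nat -> R :=
  fun n => d n * v n.

(* Main.v *)
Require Import Defs.
From HB Require Import structures.
From mathcomp Require Import all_boot all_order all_algebra.
From mathcomp Require Import all_classical all_reals all_analysis.
From mathcomp Require Import ring lra.
Set Implicit Arguments.
Unset Strict Implicit.
Unset Printing Implicit Defensive.
Import Order.TTheory GRing.Theory Num.Theory.
Import numFieldNormedType.Exports.

Local Open Scope ring_scope.

(** frakJ acts entrywise by the odd scalar function
    j t = sg t * |t|^(p-1) / (1 + |t|), so everything reduces to a scalar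
    Taylor estimate that is summable.  The second derivative of j is
    O(|t|^(p-3)), which leads to the pointwise remainder bound [taylor_frakj]

      |j (t + h) - j t - j' t * h| <= 2 p^2 (|t| + |h|)^(p-3) |h|^2.

    To pass from entries to norms one uses that conjugate exponents satisfy
    (p - 1) q = p: a sequence dominated by K |u|^a |v|^b with a + b = p - 1
    therefore has, by Hoelder with exponents p/(aq) and p/(bq), an l_q norm of
    at most K |u|_p^a |v|_p^b ([lp_hoelder_norm]).  With (a, b) = (p - 3, 2)
    the remainder of frakJ at x has norm
    O((|x| + |h|)^(p-3) |h|^2) = o(|h|), which is Frechet differentiability.
    With (a, b) = (p - 2, 1) the pointwise bound j' t <= (p - 1) |t|^(p-2)
    shows that multiplication by j' (x n) maps l_p to l_q continuously, and
    gives the norm estimate. *)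

(** * The mean value theorem on the positive half-line *)

(** Stated for both orders of x and y and with the distance of c to x, so that
    it can be iterated to reach the second derivative. *)
Lemma MVT_pos (R : realType) (f df : R -> R) (x y : R) :
  (forall z : R, 0 < z -> is_derive z 1 f (df z)) -> 0 < x -> 0 < y ->
  exists c, [/\ 0 < c, `|c - x| <= `|y - x| & f y - f x = df c * (y - x)].
Proof.
move=> fdf x0 y0.
have key a b : 0 < a -> a <= b ->
    exists2 c, c \in `[a, b] & f b - f a = df c * (b - a).
  move=> a0 ab; apply: MVT_segment => //.
    by move=> z; rewrite in_itv/= => /andP[az _]; apply: fdf; apply: lt_trans az.
  apply: derivable_within_continuous => z; rewrite in_itv/= => /andP[az _].
  by apply: ex_derive; apply: fdf; apply: lt_le_trans az.
have [xy|/ltW yx] := leP x y.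
  have [c] := key _ _ x0 xy; rewrite in_itv/= => /andP[xc cy] ->.
  exists c; split=> //; first exact: lt_le_trans xc.
  by rewrite !ger0_norm ?subr_ge0// lerB.
have [c] := key _ _ y0 yx; rewrite in_itv/= => /andP[yc cx] E.
exists c; split; first exact: lt_le_trans yc.
  by rewrite !ler0_norm ?subr_le0// lerN2 lerB.
by rewrite -opprB E -mulrN opprB.
Qed.

(** * Taylor estimate for the scalar function *)

Lemma powR_pred (R : realType) (s r : R) :
  0 <= s -> 0 < r -> s `^ r = s `^ (r - 1) * s.
Proof.
move=> s0 r0; rewrite -[X in _ = _ * X](powRr1 s0) -powRD ?subrK//.
by rewrite gt_eqF.
Qed.

Section scalar.
Context (R : realType) (p : R) (p3 : 3 < p).

Definition frakj (t : R) : R := `|t| `^ (p - 1) * Num.sg t / (1 + `|t|).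

Definition dfrakj (t : R) : R :=
  ((p - 1) * `|t| `^ (p - 2) + (p - 2) * `|t| `^ (p - 1)) / (1 + `|t|) ^+ 2.

(* On the positive half-line absolute values and signs disappear: j and dj are
   the smooth expressions that agree there with frakj and dfrakj, and ddj is
   the derivative of dj with its natural power s^(p-3) factored out. *)
Let j (s : R) : R := s `^ (p - 1) / (1 + s).
Let dj (s : R) : R :=
  ((p - 1) * s `^ (p - 2) + (p - 2) * s `^ (p - 1)) / (1 + s) ^+ 2.
Let ddj (s : R) : R := s `^ (p - 3) *
  ((p - 1) * (p - 2) / (1 + s)
   - 2 * s * ((p - 1) + (p - 2) * s) / (1 + s) ^+ 3).

(** Together with the next lemma: writes every power in terms of the single
    factor s^(p-3), after which derivative identities are rational in s. *)
Lemma powR_subr1E s : 0 <= s -> s `^ (p - 1) = s `^ (p - 3) * s ^+ 2.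
Proof.
move=> s0; rewrite -powR_mulrn// -powRD; last by rewrite gt_eqF//; move: p3; lra.
by congr (_ `^ _); ring.
Qed.

Lemma powR_subr2E s : 0 <= s -> s `^ (p - 2) = s `^ (p - 3) * s.
Proof.
move=> s0; rewrite powR_pred//; last by move: p3; lra.
by congr (_ `^ _ * _); ring.
Qed.

Lemma is_derive_j (s : R) : 0 < s -> is_derive s 1 j (dj s).
Proof.
move=> s0.
have n0 : 1 + s != 0 by rewrite gt_eqF// addr_gt0.
have Hi : is_derive s 1 (fun y : R => (1 + y)^-1) (- (1 + s) ^- 2 *: (0 + 1)).
  by apply: is_deriveV => //; exact: is_deriveD.
have := is_deriveM (is_derive1_powR (p - 1) s0) Hi.
rewrite [X in is_derive _ _ _ X -> _](_ : _ = dj s)//.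
rewrite /dj /GRing.scale/= (_ : p - 1 - 1 = p - 2); last by ring.
rewrite (powR_subr1E (ltW s0)) (powR_subr2E (ltW s0)).
by field.
Qed.

Lemma is_derive_dj (s : R) : 0 < s -> is_derive s 1 dj (ddj s).
Proof.
move=> s0.
have n0 : 1 + s != 0 by rewrite gt_eqF// addr_gt0.
have D1 : is_derive s 1 (fun y : R => 1 + y) 1.
  by rewrite -[X in is_derive _ _ _ X]add0r; exact: is_deriveD.
have D2 : is_derive s 1 (fun y : R => (1 + y) ^+ 2) (2 * (1 + s)).
  have := is_deriveM D1 D1.
  rewrite [X in is_derive _ _ _ X -> _](_ : _ = 2 * (1 + s))//.
  by rewrite /GRing.scale/=; ring.
have D3 : is_derive s 1 (fun y : R => ((1 + y) ^+ 2)^-1)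
    (- ((1 + s) ^+ 2) ^- 2 *: (2 * (1 + s))).
  by apply: is_deriveV => //; rewrite expf_neq0.
have DP1 := is_derive1_powR (p - 1) s0.
have DP2 := is_derive1_powR (p - 2) s0.
have D4 : is_derive s 1
    (fun y : R => (p - 1) * y `^ (p - 2) + (p - 2) * y `^ (p - 1))
    ((p - 1) * ((p - 2) * s `^ (p - 3)) + (p - 2) * ((p - 1) * s `^ (p - 2))).
  have D := is_deriveD (is_deriveZ (p - 1) DP2) (is_deriveZ (p - 2) DP1).
  move: D; rewrite (_ : p - 2 - 1 = p - 3); last by ring.
  by rewrite (_ : p - 1 - 1 = p - 2); last by ring.
have := is_deriveM D4 D3.
rewrite [X in is_derive _ _ _ X -> _](_ : _ = ddj s)//.
rewrite /ddj /GRing.scale/=.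
rewrite (powR_subr1E (ltW s0)) (powR_subr2E (ltW s0)).
by field.
Qed.

(** Both terms of the cofactor of s^(p-3) in ddj are nonnegative; they are at
    most (p - 1) (p - 2) and 2 (p - 1), the latter because s <= 1 + s and
    (p - 1) + (p - 2) s <= (p - 1) (1 + s). *)
Lemma ddj_le (s : R) : 0 < s -> `|ddj s| <= p * (p - 1) * s `^ (p - 3).
Proof.
move=> s0; have s1 : 0 < 1 + s by rewrite addr_gt0.
rewrite /ddj normrM ger0_norm ?powR_ge0// mulrC ler_wpM2r ?powR_ge0//.
have A0 : 0 <= (p - 1) * (p - 2) / (1 + s).
  by rewrite divr_ge0 ?(ltW s1)// mulr_ge0//; move: p3; lra.
have A1 : (p - 1) * (p - 2) / (1 + s) <= (p - 1) * (p - 2).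
  rewrite ler_pdivrMr// ler_peMr ?lerDl ?(ltW s0)//.
  by rewrite mulr_ge0//; move: p3; lra.
have B0 : 0 <= 2 * s * ((p - 1) + (p - 2) * s) / (1 + s) ^+ 3.
  rewrite divr_ge0 ?exprn_ge0 ?(ltW s1)// mulr_ge0//; first by move: s0; lra.
  by move: p3 s0; nra.
have B1 : 2 * s * ((p - 1) + (p - 2) * s) / (1 + s) ^+ 3 <= 2 * (p - 1).
  rewrite ler_pdivrMr ?exprn_gt0// -mulrA -[leRHS]mulrA ler_pM2l//.
  have -> : (p - 1) * (1 + s) ^+ 3 = (1 + s) ^+ 2 * ((p - 1) * (1 + s)) by ring.
  by apply: ler_pM; move: p3 s0; nra.
by rewrite ler_norml; move: A0 A1 B0 B1 p3; nra.
Qed.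

Lemma frakjN (t : R) : frakj (- t) = - frakj t.
Proof. by rewrite /frakj normrN sgrN mulrN mulNr. Qed.

Lemma dfrakjN (t : R) : dfrakj (- t) = dfrakj t.
Proof. by rewrite /dfrakj normrN. Qed.

Lemma frakj_le (t : R) : `|frakj t| <= `|t| `^ (p - 1).
Proof. exact: (frakJ_fun_le p (fun=> t) 0). Qed.

Lemma dfrakj_ge0 (t : R) : 0 <= dfrakj t.
Proof.
rewrite divr_ge0 ?exprn_ge0 ?addr_ge0// mulr_ge0 ?powR_ge0//; have := p3; lra.
Qed.

(** The denominator absorbs the higher power, since
    (p - 1) + (p - 2) |t| <= (p - 1) (1 + |t|)^2. *)
Lemma dfrakj_le (t : R) : dfrakj t <= (p - 1) * `|t| `^ (p - 2).
Proof.
have t0 : 0 <= `|t| by [].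
rewrite /dfrakj ler_pdivrMr ?exprn_gt0 ?ltr_pwDl//.
rewrite powR_subr1E// powR_subr2E//.
have := powR_ge0 `|t| (p - 3); set w := _ `^ _ => w0.
rewrite [leLHS](_ : _ = (w * `|t|) * ((p - 1) + (p - 2) * `|t|)); last by ring.
rewrite [leRHS](_ : _ = (w * `|t|) * ((p - 1) * (1 + `|t|) ^+ 2)); last by ring.
by rewrite ler_wpM2l ?mulr_ge0//; move: p3 t0; nra.
Qed.

(** When |h| < t the segment from t to t + h stays in the positive half-line,
    and two applications of the mean value theorem produce a value of ddj at a
    point d <= t + |h|; the power p - 3 is positive, so s^(p-3) is
    nondecreasing. *)
Lemma taylor_frakj_pos (t h : R) : 0 < t -> `|h| < t ->
  `|frakj (t + h) - frakj t - dfrakj t * h| <=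
  p * (p - 1) * (t + `|h|) `^ (p - 3) * `|h| ^+ 2.
Proof.
move=> t0 ht; have th0 : 0 < t + h by move: ht; rewrite ltr_norml; lra.
have jE s : 0 < s -> frakj s = j s.
  by move=> s0; rewrite /frakj /j gtr0_norm// gtr0_sg// mulr1.
have -> : dfrakj t = dj t by rewrite /dfrakj /dj gtr0_norm.
rewrite !jE//.
have [c [c0 ch ->]] := MVT_pos is_derive_j t0 th0.
have [d [d0 dc E]] := MVT_pos is_derive_dj t0 c0.
move: ch dc; rewrite addrAC subrr add0r => ch dc.
rewrite -mulrBl normrM E normrM expr2 mulrA ler_wpM2r//.
apply: ler_pM => //.
apply: le_trans (ddj_le d0) _; rewrite ler_wpM2l//; first by move: p3; nra.
have p30 : 0 <= p - 3 by move: p3; lra.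
apply: (ge0_ler_powR p30); rewrite ?nnegrE ?addr_ge0 ?(ltW d0) ?(ltW t0)//.
by rewrite /= -lerBlDl (le_trans (ler_norm _))// (le_trans dc).
Qed.

(** If |h| < |t|, no sign change occurs and oddness reduces to t > 0.  If
    |t| <= |h|, there is nothing to expand: each of the three terms is
    O((|t| + |h|)^(p-1)), and (|t| + |h|)^2 <= 4 |h|^2.  This split avoids
    differentiating at 0. *)
Lemma taylor_frakj (t h : R) :
  `|frakj (t + h) - frakj t - dfrakj t * h| <=
  2 * p ^+ 2 * (`|t| + `|h|) `^ (p - 3) * `|h| ^+ 2.
Proof.
have [ht|th] := ltP `|h| `|t|.
  apply: (@le_trans _ _ (p * (p - 1) * (`|t| + `|h|) `^ (p - 3) * `|h| ^+ 2)).
    have [t0|t0|t0] := ltgtP 0 t; last first.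
    - by move: ht; rewrite -t0 normr0 ltNge normr_ge0.
    - have := @taylor_frakj_pos (- t) (- h).
      rewrite -opprD !frakjN dfrakjN mulrN -!opprD !normrN (ltr0_norm t0).
      by apply; rewrite ?oppr_gt0// -(ltr0_norm t0).
    - by rewrite (gtr0_norm t0) in ht *; exact: taylor_frakj_pos.
  by rewrite !ler_wpM2r ?powR_ge0 ?exprn_ge0//; move: p3; nra.
set M := `|t| + `|h|.
have M0 : 0 <= M by rewrite addr_ge0.
have tM : `|t| <= M by rewrite lerDl.
have hM : `|h| <= M by rewrite lerDr.
have pow r s : 0 <= r -> 0 <= s -> s <= M -> s `^ r <= M `^ r.
  by move=> r0 s0 sM; apply: ge0_ler_powR; rewrite ?nnegrE.
have H1 : `|frakj (t + h)| <= M `^ (p - 1).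
  by rewrite (le_trans (frakj_le _))// pow ?ler_normD//; move: p3; lra.
have H2 : `|frakj t| <= M `^ (p - 1).
  by rewrite (le_trans (frakj_le _))// pow//; move: p3; lra.
have H3 : `|dfrakj t * h| <= (p - 1) * M `^ (p - 1).
  rewrite normrM (ger0_norm (dfrakj_ge0 t)) [M `^ (p - 1)]powR_pred//; last first.
    by move: p3; lra.
  rewrite mulrA ler_pM ?dfrakj_ge0// (le_trans (dfrakj_le _))//.
  rewrite (_ : p - 1 - 1 = p - 2); last by ring.
  by rewrite ler_wpM2l ?pow//; move: p3; lra.
rewrite (le_trans (ler_normB _ _))// (le_trans (lerD (ler_normB _ _) (lexx _)))//.
(* p + 1 = 1 + 1 + (p - 1) adds up the constants of the three terms *)
apply: (@le_trans _ _ ((p + 1) * M `^ (p - 1))).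
  by move: H1 H2 H3; lra.
rewrite powR_subr1E//.
have := powR_ge0 M (p - 3); set w := _ `^ _ => w0.
rewrite [leLHS](_ : _ = w * ((p + 1) * M ^+ 2)); last by ring.
rewrite [leRHS](_ : _ = w * (2 * p ^+ 2 * `|h| ^+ 2)); last by ring.
rewrite ler_wpM2l//.
have M2 : M ^+ 2 <= 4 * `|h| ^+ 2.
  have -> : 4 * `|h| ^+ 2 = (2 * `|h|) ^+ 2 by ring.
  by rewrite ler_sqr ?nnegrE ?mulr_ge0// /M; move: th; lra.
apply: (@le_trans _ _ ((p + 1) * (4 * `|h| ^+ 2))).
  by rewrite ler_wpM2l//; move: p3; lra.
by rewrite mulrA ler_wpM2r ?exprn_ge0//; move: p3; nra.
Qed.
End scalar.

(** * Products of powers of l_p sequences *)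

Section hoelder_product.
Context (R : realType) (p q : R) (p1 : (1 <= p%:E)%E) (q1 : (1 <= q%:E)%E).

(** Hoelder's inequality for |u|^(aq) and |v|^(bq) with exponents p/(aq) and
    p/(bq), which are conjugate precisely because (a + b) q = p; each factor
    then contributes a power of the p-norm of u or v. *)
Lemma lp_hoelder_sum (a b K : R) (u v : lp p1) (w : nat -> R) :
  0 < a -> 0 < b -> 0 <= K -> (a + b) * q = p ->
  (forall n, `|w n| <= K * `|u n| `^ a * `|v n| `^ b) ->
  (\sum_(n <oo) (`|w n| `^ q)%:E <= ((K * `|u| `^ a * `|v| `^ b) `^ q)%:E)%E.
Proof.
move=> a0 b0 K0 abq wuv.
have p0 : 0 < p by rewrite (lt_le_trans ltr01).
have q0 : 0 < q by rewrite (lt_le_trans ltr01).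
have N0 r (z : lp p1) n : 0 <= `|z n| `^ r by exact: powR_ge0.
have hold r (z : lp p1) : 0 < r ->
    ('N[@counting nat R]_(p / (r * q))%:E[EFin \o (fun n => (`|z n| `^ (r * q))%R)]
     = (`|z| `^ (r * q))%:E)%E.
  move=> r0; have rq0 : 0 < r * q by rewrite mulr_gt0.
  rewrite Lnorm_counting ?divr_gt0// -poweR_EFin lp_normE -poweRrM invf_div.
  rewrite [in RHS]mulrC; congr (_ `^ _)%E; apply: eq_eseriesr => n _ /=.
  rewrite (ger0_norm (powR_ge0 _ _)) -powRrM; congr (_ `^ _)%:E.
  by rewrite mulrCA divff ?mulr1// gt_eqF.
have cq : (p / (a * q))^-1 + (p / (b * q))^-1 = 1.
  by rewrite !invf_div -mulrDl -mulrDl abq divff// gt_eqF.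
have := @hoelder _ _ _ (@counting nat R) (fun n => `|u n| `^ (a * q))
  (fun n => `|v n| `^ (b * q)) _ _ _ _ _ _ cq.
rewrite !hold// Lnorm_counting// => H.
apply: (@le_trans _ _ ((K `^ q)%:E *
    \sum_(n <oo) (`|u n| `^ (a * q) * `|v n| `^ (b * q))%:E)%E).
  rewrite -nneseriesZl; last by move=> n _; rewrite lee_fin mulr_ge0.
  apply: lee_nneseries => n _; first by rewrite lee_fin powR_ge0.
  rewrite -EFinM lee_fin !powRrM -!powRM ?mulr_ge0// mulrA.
  by apply: ge0_ler_powR; rewrite ?nnegrE ?mulr_ge0// ltW.
rewrite !powRM ?mulr_ge0 ?powR_ge0// -mulrA EFinM lee_wpmul2l ?lee_fin ?powR_ge0//.
rewrite -!powRrM EFinM; apply: le_trans (H _ _ _ _); last 4 first.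
- by [].
- by [].
- by rewrite divr_gt0// mulr_gt0.
- by rewrite divr_gt0// mulr_gt0.
rewrite invr1 poweRe1; last first.
  by apply: nneseries_ge0 => n _ _; exact: poweR_ge0.
apply: lee_nneseries => n _; first by rewrite lee_fin mulr_ge0.
rewrite /= (ger0_norm (mulr_ge0 (powR_ge0 _ _) (powR_ge0 _ _))).
by rewrite powRr1 ?mulr_ge0.
Qed.

Lemma lp_hoelder_in (a b K : R) (u v : lp p1) (w : nat -> R) :
  0 < a -> 0 < b -> 0 <= K -> (a + b) * q = p ->
  (forall n, `|w n| <= K * `|u n| `^ a * `|v n| `^ b) ->
  w \in Lfun (@counting nat R) q%:E.
Proof.
move=> a0 b0 K0 abq wuv; apply/in_lpP; first by rewrite (lt_le_trans ltr01).
exact: le_lt_trans (lp_hoelder_sum a0 b0 K0 abq wuv) (ltry _).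
Qed.

Lemma lp_hoelder_norm (a b K : R) (u v : lp p1) (w : lp q1) :
  0 < a -> 0 < b -> 0 <= K -> (a + b) * q = p ->
  (forall n, `|w n| <= K * `|u n| `^ a * `|v n| `^ b) ->
  `|w| <= K * `|u| `^ a * `|v| `^ b.
Proof.
move=> a0 b0 K0 abq wuv; have q0 : 0 < q by rewrite (lt_le_trans ltr01).
rewrite -lee_fin lp_normE.
have S0 : (0 <= \sum_(n <oo) (`|w n| `^ q)%:E)%E.
  by apply: nneseries_ge0 => n _ _; rewrite lee_fin powR_ge0.
set B := K * _ * _; have B0 : 0 <= B by rewrite !mulr_ge0 ?powR_ge0.
have -> : (B%:E = (B `^ q)%:E `^ q^-1)%E.
  by rewrite poweR_EFin -powRrM divff ?gt_eqF// powRr1.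
apply: gt0_ler_poweR; rewrite ?in_itv/= ?leey ?andbT ?lee_fin ?powR_ge0//.
  by rewrite invr_ge0 ltW.
exact: (lp_hoelder_sum a0 b0 K0 abq wuv).
Qed.
End hoelder_product.

(** * Entrywise absolute value on l_p *)

Lemma lp_abs_subproof (R : realType) (p : R) (p1 : (1 <= p%:E)%E) (x : lp p1) :
  (fun n => `|x n|) \in Lfun (@counting nat R) p%:E.
Proof.
have p0 : 0 < p by rewrite (lt_le_trans ltr01).
have /(in_lpP _ p0) : (x : nat -> R) \in Lfun (@counting nat R) p%:E.
  exact: LfunP.
move=> xp; apply/in_lpP => //; under eq_eseriesr do rewrite normr_id.
exact: xp.
Qed.

(** The remainder bound involves |x n| + |h n|, the entries of
    lp_abs x + lp_abs h, whose norm the triangle inequality controls. *)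
Definition lp_abs (R : realType) (p : R) (p1 : (1 <= p%:E)%E) (x : lp p1) :
  lp p1 := Lfun_Sub p1 (lp_abs_subproof x).

Lemma norm_lp_abs (R : realType) (p : R) (p1 : (1 <= p%:E)%E) (x : lp p1) :
  `|lp_abs x| = `|x|.
Proof.
apply: EFin_inj; rewrite !lp_normE; congr (_ `^ _)%E.
by apply: eq_eseriesr => n _; rewrite /= normr_id.
Qed.

(** * The differential of frakJ *)

Section differential.
Context (R : realType) (p q : R) (p3 : 3 < p) (pq : p^-1 + q^-1 = 1).
Notation lP := (lp (exponent_ge1 p3)).
Notation lQ := (lp (conjugate_ge1 p3 pq)).

(** The trivial power `^ 1 puts the bound in the shape required by
    [lp_hoelder_norm], with exponents p - 2 and 1. *)
Lemma dfrakj_mul_le (x v : lP) (n : nat) :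
  `|diag_act (fun n => dfrakj p (x n)) v n| <=
  (p - 1) * `|x n| `^ (p - 2) * `|v n| `^ 1.
Proof.
rewrite powRr1// normrM (ger0_norm (dfrakj_ge0 p3 _)) ler_wpM2r//.
exact: dfrakj_le.
Qed.

Let p10 : 0 <= p - 1. Proof. by move: p3; lra. Qed.
Let p20 : 0 < p - 2. Proof. by move: p3; lra. Qed.
Let p30 : 0 < p - 3. Proof. by move: p3; lra. Qed.
Let K0 : 0 <= 2 * p ^+ 2. Proof. by rewrite mulr_ge0// sqr_ge0. Qed.
Let pq1 : (p - 2 + 1) * q = p.
Proof. by rewrite -[RHS](conjugateE p3 pq); congr (_ * _); ring. Qed.
Let pq2 : (p - 3 + 2) * q = p.
Proof. by rewrite -[RHS](conjugateE p3 pq); congr (_ * _); ring. Qed.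

Lemma dfrakJ_subproof (x v : lP) :
  diag_act (fun n => dfrakj p (x n)) v \in Lfun (@counting nat R) q%:E.
Proof.
exact: (lp_hoelder_in (conjugate_ge1 p3 pq) p20 ltr01 p10 pq1 (dfrakj_mul_le x v)).
Qed.

Definition dfrakJ (x v : lP) : lQ :=
  Lfun_Sub (conjugate_ge1 p3 pq) (dfrakJ_subproof x v).

Lemma dfrakJ_is_linear (x : lP) : linear (dfrakJ x).
Proof.
move=> k u v; apply/LfuneqP => n.
change (dfrakj p (x n) * (k * u n + v n) =
        k * (dfrakj p (x n) * u n) + dfrakj p (x n) * v n).
by ring.
Qed.

HB.instance Definition _ (x : lP) :=
  GRing.isLinear.Build R lP lQ *:%R (dfrakJ x) (dfrakJ_is_linear x).

Lemma dfrakJ_norm (x v : lP) :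
  `|dfrakJ x v| <= (p - 1) * `|x| `^ (p - 2) * `|v|.
Proof.
have := @lp_hoelder_norm _ _ _ _ _ _ _ _ x v (dfrakJ x v)
  p20 ltr01 p10 pq1 (dfrakj_mul_le x v).
by rewrite powRr1.
Qed.

(** The scalar remainder bound has exponents p - 3 and 2 in lp_abs x + lp_abs h
    and h, whose sum is p - 1. *)
Lemma taylor_frakJ (x h : lP) :
  `|frakJ p3 pq (h + x) - frakJ p3 pq x - dfrakJ x h| <=
  2 * p ^+ 2 * (`|x| + `|h|) `^ (p - 3) * `|h| ^+ 2.
Proof.
rewrite -(powR_mulrn 2 (normr_ge0 h)).
apply: (@le_trans _ _
    (2 * p ^+ 2 * `|lp_abs x + lp_abs h| `^ (p - 3) * `|h| `^ 2)).
  apply: lp_hoelder_norm => // n.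
  rewrite powR_mulrn//.
  have -> : `|(lp_abs x + lp_abs h) n| = `|x n| + `|h n|.
    by rewrite -[LHS]/(`| `|x n| + `|h n| |) ger0_norm// addr_ge0.
  rewrite [h + x]addrC; exact: (taylor_frakj p3 (x n) (h n)).
rewrite ler_wpM2r ?powR_ge0// ler_wpM2l//.

apply: ge0_ler_powR; rewrite ?nnegrE ?(ltW p30)// ?addr_ge0//.
by rewrite -(norm_lp_abs x) -(norm_lp_abs h) ler_normD.
Qed.

Lemma dfrakJ_continuous (x : lP) : continuous (dfrakJ x).
Proof.
apply/linear_bounded_continuous/linear_boundedP.
exists ((p - 1) * `|x| `^ (p - 2)); split; first exact: num_real.
move=> M /ltW HM v; apply: le_trans (dfrakJ_norm x v) _.
by rewrite ler_wpM2r.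
Qed.

Lemma frakJ_expansion (x : lP) :
  frakJ p3 pq \o shift x = cst (frakJ p3 pq x) + dfrakJ x +o_ 0 id.
Proof.
apply/eqaddoP => _/posnumP[e].
(* C bounds the coefficient of |h|^2 in the remainder as soon as |h| <= 1 *)
set C := 2 * p ^+ 2 * (`|x| + 1) `^ (p - 3).
have C0 : 0 <= C by rewrite mulr_ge0// powR_ge0.
near=> h.
have -> : (frakJ p3 pq \o shift x - (cst (frakJ p3 pq x) + dfrakJ x)) h =
    frakJ p3 pq (h + x) - frakJ p3 pq x - dfrakJ x h.
  by rewrite !fctE opprD addrA.
apply: le_trans (taylor_frakJ x h) _.
have h1 : `|h| <= 1 by near: h; exact: nbhs0_le.
(* C + 1 instead of C keeps the denominator nonzero *)
have he : `|h| <= e%:num / (C + 1).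
  by near: h; apply: nbhs0_le; rewrite divr_gt0// ltr_wpDl.
apply: (@le_trans _ _ (C * `|h| ^+ 2)).
  rewrite ler_wpM2r ?exprn_ge0// ler_wpM2l//.
  by apply: ge0_ler_powR; rewrite ?nnegrE ?(ltW p30) ?addr_ge0// lerD2l.
rewrite expr2 mulrA ler_wpM2r//.
apply: (@le_trans _ _ ((C + 1) * `|h|)); first by rewrite ler_wpM2r// lerDl.
by rewrite mulrC -ler_pdivlMr// ltr_wpDl.
Unshelve. all: by end_near. Qed.

(** By uniqueness of the continuous linear map in a first-order expansion. *)
Lemma diff_frakJ (x : lP) : 'd (frakJ p3 pq) x = dfrakJ x :> (lP -> lQ).
Proof. exact: diff_unique (@dfrakJ_continuous x) (frakJ_expansion x). Qed.

Lemma differentiable_frakJ (x : lP) : differentiable (frakJ p3 pq) x.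
Proof.
apply/diff_locallyP; rewrite diff_frakJ; split.
  exact: dfrakJ_continuous.
exact: frakJ_expansion.
Qed.

End differential.

(** * Differentiability and the norm estimate *)

Theorem theorem7p2 (R : realType) (p q : R)
    (p3 : 3 < p) (pq : p^-1 + q^-1 = 1) :
  (forall x : lp (exponent_ge1 p3), differentiable (frakJ p3 pq) x) /\
  forall x : lp (exponent_ge1 p3),
    (forall v : lp (exponent_ge1 p3),
      ('d (frakJ p3 pq) x v : nat -> R) =
      diag_act (fun n => ((p - 1) * `|x n| `^ (p - 2)
                          + (p - 2) * `|x n| `^ (p - 1))
                         / (1 + `|x n|) ^+ 2) v) /\
    (forall (v : lp (exponent_ge1 p3)) (n : nat),
      'd (frakJ p3 pq) x v n =
      ((p - 1) * `|x n| `^ (p - 2) + (p - 2) * `|x n| `^ (p - 1))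
      / (1 + `|x n|) ^+ 2 * v n) /\
    (forall v : lp (exponent_ge1 p3),
      `|'d (frakJ p3 pq) x v| <=
      ((p - 1) * `|x| `^ (p - 2) + (p - 2) * `|x| `^ (p - 1)) * `|v|).
Proof.
split=> [x|x]; first exact: differentiable_frakJ.
rewrite diff_frakJ; split; [by []|split; first by []].
move=> v; apply: le_trans (dfrakJ_norm pq x v) _.
rewrite ler_wpM2r// lerDl mulr_ge0 ?powR_ge0//; have := p3; lra.
Qed.
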